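(* Let $d$ be the dimension, $m=d$, $\lambda>0$ with $\log d\lesssim \lambda\lesssim d$, and $w_\star,v\in\mathbb{S}^{d-1}$ with $v^\top w_\star=0$. Let $Q=I_d+\lambda vv^\top$, $P_\perp=I_d-w_\star w_\star^\top-vv^\top$, and $\mathcal L(W)=\mathbb{E}\big(y-\sum_{j=1}^m(w_j^\top x)^2\big)^2$ with $x\sim\mathcal N(0,Q)$, $y=(x^\top w_\star)^2+\nu$, $\nu\sim\mathcal N(0,\sigma^2)$ independent. Initialize $W_0=\theta U$ with $U^\top$ uniform on the Stiefel manifold (so $W_0W_0^\top=\theta^2I_d$), $\theta^2=\rho_0/d$, $\rho_0=1/\log d$, and run $W_{k+1}=W_k-\eta\,\mathrm{polar}(\nabla_W\mathcal L(W_k))$ with $\eta=\kappa/\sqrt{d+\lambda}$ for a sufficiently small absolute constant $\kappa>0$. Write $W_kW_k^\top=a_k w_\star w_\star^\top+b_k vv^\top+c_kP_\perp$, $T_1:=\inf\{k\ge0: b_{k+1}\le b_k\}$, and for a fixed sufficiently small constant $\delta>0$, $T_2:=\inf\{k\ge T_1: a_k\ge\delta\}$. Then for $d$ large enough: (i) $T_2=O(\eta^{-1})$; (ii) $a_k=(\sqrt{a_0}+k\eta)^2$ for all $T_1\le k\le T_2$, and $b_k=O((1+\lambda)^{-1})$, $c_k=O(d^{-1})$ for all $k\ge T_1$. Furthermore, for all $k\ge T_2$, $a_k=\Theta(1)$ and $\mathrm{Align}(k)=1-o(1)$.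
   Context: $\mathrm{polar}(A):=A(A^\top A)^{-1/2}$ (Moore–Penrose inverse square root). The alignment is $\mathrm{Align}(k)=\frac{\langle M_k,w_\star w_\star^\top\rangle_F}{\|M_k\|_F}=\frac{a_k}{\sqrt{a_k^2+b_k^2+(d-2)c_k^2}}$ with $M_k=W_kW_k^\top$. Asymptotic notation refers to $d\to\infty$. *)

(* Defs.v *)
From HB Require Import structures.
From mathcomp Require Import all_boot all_order all_algebra.
From mathcomp Require Import all_classical all_reals all_analysis.
Set Implicit Arguments. Unset Strict Implicit. Unset Printing Implicit Defensive.
Import Order.TTheory GRing.Theory Num.Theory.
Local Open Scope classical_set_scope.
Local Open Scope ring_scope.

Section Defs.
Variable R : realType.

Definition std_normal_pdf (t : R) : R :=
  (Num.sqrt (2 * pi))^-1 * expR (- (t ^+ 2) / 2).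

Definition ncons (t : R) (z : nat -> R) : nat -> R :=
  fun k => if k is k'.+1 then z k' else t.

(* E[f(Z_0,...,Z_{n-1})] for Z_i i.i.d. N(0,1), as an iterated Lebesgue integral
   against the Gaussian density (coordinates >= n are set to 0). *)
Fixpoint gauss_exp (n : nat) (f : (nat -> R) -> R) : R :=
  match n with
  | 0 => f (fun _ => 0)
  | n'.+1 => Rintegral lebesgue_measure setT
               (fun t => std_normal_pdf t * gauss_exp n' (fun z => f (ncons t z)))
  end.

Definition psd (d : nat) (S : 'M[R]_d) : Prop :=
  S^T = S /\ forall u : 'cV[R]_d, 0 <= (u^T *m S *m u) 0 0.

Definition psd_sqrt (d : nat) (S : 'M[R]_d) : 'M[R]_d :=
  xget 0 [set Y | psd Y /\ Y *m Y = S].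

Definition mp_pinv (d : nat) (S : 'M[R]_d) : 'M[R]_d :=
  xget 0 [set X | S *m X *m S = S /\ X *m S *m X = X /\
                  (S *m X)^T = S *m X /\ (X *m S)^T = X *m S].

Definition polar (d : nat) (A : 'M[R]_d) : 'M[R]_d :=
  A *m psd_sqrt (mp_pinv (A^T *m A)).

(* L(W) = E (y - sum_j (w_j^T x)^2)^2, x ~ N(0,Q), y = (x^T wstar)^2 + nu,
   nu ~ N(0, sigma^2) independent; x = Q^{1/2} z, nu = sigma * z_d. *)
Definition loss (d : nat) (Q : 'M[R]_d) (wstar : 'cV[R]_d) (sigma : R)
  (W : 'M[R]_d) : R :=
  gauss_exp d.+1 (fun z =>
    let x := psd_sqrt Q *m \col_(i < d) z i in
    let y := ((x^T *m wstar) 0 0) ^+ 2 + sigma * z d in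
    (y - \sum_(j < d) (((col j W)^T *m x) 0 0) ^+ 2) ^+ 2).

Definition gradW (d : nat) (L : 'M[R]_d -> R) (W : 'M[R]_d) : 'M[R]_d :=
  \matrix_(i < d, j < d) derive1 (fun t : R => L (W + t *: delta_mx i j)) 0.

Fixpoint polar_gd (d : nat) (L : 'M[R]_d -> R) (eta : R) (W0 : 'M[R]_d)
  (k : nat) : 'M[R]_d :=
  match k with
  | 0 => W0
  | k'.+1 => let W := polar_gd L eta W0 k' in W - eta *: polar (gradW L W)
  end.

Definition frob_dot (d : nat) (A B : 'M[R]_d) : R := \tr (A^T *m B).
Definition frob_norm (d : nat) (A : 'M[R]_d) : R := Num.sqrt (frob_dot A A).

Definition align (d : nat) (M : 'M[R]_d) (wstar : 'cV[R]_d) : R :=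
  frob_dot M (wstar *m wstar^T) / frob_norm M.

End Defs.

(* Main.v *)
Require Import Defs.
From HB Require Import structures.
From mathcomp Require Import all_boot all_order all_algebra.
From mathcomp Require Import all_classical all_reals all_analysis.
From mathcomp Require Import measurable_realfun ring lra.
Set Implicit Arguments. Unset Strict Implicit. Unset Printing Implicit Defensive.
Import Order.TTheory GRing.Theory Num.Theory.
Import numFieldNormedType.Exports.
Local Open Scope classical_set_scope.
Local Open Scope ring_scope.

(* For x ~ N(0, Q) the loss is 2 tr(DQDQ) + tr(DQ)^2 + sigma^2 with
   D = w w^T - W W^T, so its gradient is -4 (2 QDQ + tr(DQ) Q) W.  The matrices
   a w w^T + b v v^T + c P form a commutative algebra containing Q, and W_k stays
   of the form (al w w^T + be v v^T + ga P) U: a polar step adds eta times a sign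
   to each of al, be, ga.  With L = 1 + lambda, n = d - 2 and
   s = 1 - al^2 - L be^2 - n ga^2, the signs are those of 2 (1 - al^2) + s,
   s - 2 L be^2 and s - 2 ga^2 (times the coordinate).  Hence be can only grow while
   L be^2 < 1/3 and ga only while n ga^2 < 1, which bounds L be^2 and n ga^2 for all
   times; these bounds force al to grow whenever al^2 < 1/3, and al cannot grow past
   al = 1.  The three coordinates move in lockstep until be first stops growing. *)

(** * Gaussian moments up to order four, by integration by parts *)

(** One of two factors [expR (- t^2/4)] absorbs the power: with u = t^2/4 the exponential series
    gives u^k / k! <= e^u, which bounds t^(2k), and |t|^k <= 1 + t^(2k). The other factor remains as
    an integrable dominant. *)
Lemma power_gauss_bound (R : realType) (k : nat) (t : R) :
  `|t ^+ k * expR (- (t ^+ 2) / 2)| <=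
    (1 + 4 ^+ k * k`!%:R) * expR (- (t ^+ 2) / 4).
Proof.
have -> : expR (- (t ^+ 2) / 2) = expR (- (t ^+ 2) / 4) * expR (- (t ^+ 2) / 4).
  by rewrite -expRD; congr expR; field.
rewrite mulrA normrM (ger0_norm (expR_ge0 _)) ler_wpM2r ?expR_ge0//.
rewrite normrM (ger0_norm (expR_ge0 _)) normrX.
have e0 : 0 < expR (t ^+ 2 / 4) by exact: expR_gt0.
rewrite mulNr expRN ler_pdivrMr//.
have t2 : 0 <= t ^+ 2 / 4 by rewrite divr_ge0 ?sqr_ge0.
have e1 : 1 <= expR (t ^+ 2 / 4) by rewrite -[leLHS]expR0 ler_expR.
have f0 : 0 < (k`!%:R : R) by rewrite ltr0n fact_gt0.
have H : (t ^+ 2 / 4) ^+ k / k`!%:R <= expR (t ^+ 2 / 4).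
  case: k f0 => [|k] f0; first by rewrite expr0 fact0 divr1.
  by apply: le_trans (expR_ge1Dxn k t2); rewrite lerDr.
have H2 : `|t| ^+ k <= 1 + (`|t| ^+ k) ^+ 2.
  have : 0 <= (`|t| ^+ k - 1) ^+ 2 + 1 + (`|t| ^+ k) ^+ 2 by rewrite !addr_ge0 ?sqr_ge0.
  lra.
apply: (le_trans H2); rewrite mulrDl mul1r lerD//.
rewrite -exprM mulnC exprM real_normK ?num_real//.
rewrite ler_pdivrMr // exprMn exprVn ler_pdivrMr ?exprn_gt0// in H.
by rewrite (le_trans H)// le_eqVlt; apply/orP; left; apply/eqP; ring.
Qed.
(** Up to a constant this is the density of N(0, 2). *)
Lemma gauss_quarter_integrable (R : realType) :
  lebesgue_measure.-integrable [set: R] (fun t : R => (expR (- (t ^+ 2) / 4))%:E).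
Proof.
have s2 : Num.sqrt 2 != 0 :> R by rewrite gt_eqF// sqrtr_gt0.
have := @integrable_normal_pdf R 0 (Num.sqrt 2).
move=> /(integrableZl measurableT (normal_peak (Num.sqrt 2))^-1).
apply: eq_integrable => // t _.
rewrite normal_pdfE// -EFinM mulrA mulVf ?gt_eqF ?normal_peak_gt0// mul1r.
by rewrite /normal_fun subr0 sqr_sqrtr//; congr (expR (_ / _))%:E; ring.
Qed.

Lemma power_gauss_integrable (R : realType) (k : nat) :
  lebesgue_measure.-integrable [set: R]
    (EFin \o (fun t : R => t ^+ k * expR (- (t ^+ 2) / 2))).
Proof.
pose K : R := 1 + 4 ^+ k * k`!%:R.
have := integrableZl measurableT K (gauss_quarter_integrable R).
apply: le_integrable => //.
  apply/measurable_EFinP; apply: measurable_funM => //=.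
  apply: measurableT_comp => //; apply: measurable_funM => //=.
  exact: measurableT_comp.
move=> t _ /=; rewrite lee_fin (le_trans (power_gauss_bound k t))//.
exact: ler_norm.
Qed.

(** The sign [s] is 1 or -1, so both boundary terms of an integration by parts over [-n, n] are
    covered. *)
Lemma power_gauss_cvg0 (R : realType) (k : nat) (s : R) : s ^+ 2 = 1 ->
  (s * n%:R) ^+ k * expR (- ((s * n%:R) ^+ 2) / 2) @[n --> \oo] --> (0 : R).
Proof.
move=> s1; pose K : R := 1 + 4 ^+ k * k`!%:R.
have K0 : 0 <= K by rewrite addr_ge0// mulr_ge0// exprn_ge0.
apply: norm_cvg0.
apply: (@squeeze_cvgr _ _ _ _ (fun=> 0) (fun n : nat => K * expR (- (n%:R / 4)))).
- apply: nearW => n; rewrite normr_ge0/= (le_trans (power_gauss_bound k _))//.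
  rewrite ler_wpM2l// ler_expR exprMn s1 mul1r mulNr lerN2 ler_wpM2r//.
  (* Since n <= n^2, the Gaussian tail is compared with e^(-n/4). *)
  by case: n => [|n]; rewrite ?expr0n// expr2 ler_peMr ?ler0n// ler1n.
- exact: cvg_cst.
- rewrite -[X in _ --> X](mulr0 K); apply: cvgM; first exact: cvg_cst.
  apply: (cvg_comp (fun n : nat => n%:R / 4 : R) (fun x => expR (- x)));
    last exact: cvgr_expR.
  apply/cvgryPge => r; near=> n; rewrite ler_pdivlMr//.
  near: n; exact: nbhs_infty_ger.
Unshelve. all: by end_near. Qed.

(** The fundamental theorem of calculus on [-n, n] gives F(n) - F(-n), which tends to 0; dominated
    convergence with dominant |f| identifies the limit with the full integral. *)
Lemma Rintegral_derive_vanishing (R : realType) (f F : R -> R) :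
  continuous f -> (forall x : R, is_derive x (1 : R) F (f x)) ->
  lebesgue_measure.-integrable [set: R] (EFin \o f) ->
  F n%:R @[n --> \oo] --> (0 : R) -> F (- n%:R) @[n --> \oo] --> (0 : R) ->
  Rintegral lebesgue_measure setT f = 0.
Proof.
move=> cf dF intf F1 F2.
pose D n : set R := `[- n%:R, n%:R]%classic.
have mf : measurable_fun [set: R] (EFin \o f) by case/integrableP : intf.
have mfn n : measurable_fun [set: R] ((EFin \o f) \_ (D n)).
  apply/(@measurable_restrictT _ _ _ _ (D n) (EFin \o f));
    first exact: measurable_itv. exact: measurable_funTS mf.
have fn_f : {ae lebesgue_measure, forall x : R, setT x ->
    ((EFin \o f) \_ (D n)) x @[n --> \oo] --> (EFin \o f) x}.
  apply: aeW => x _; apply: cvg_near_cst; near=> n.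
  rewrite patchE ifT// inE /D /= in_itv/= -ler_norml.
  near: n; exact: nbhs_infty_ger.
have fn_le : {ae lebesgue_measure, forall (x : R) n, setT x ->
    (`|((EFin \o f) \_ (D n)) x| <= (abse \o (EFin \o f)) x)%E}.
  apply: aeW => x n _; rewrite patchE; case: ifP => //= _.
  by rewrite normr0 lee_fin.
have [_ _] := @dominated_convergence _ _ R (@lebesgue_measure R) setT measurableT
  (fun n => (EFin \o f) \_ (D n)) (EFin \o f) _ mfn mf fn_f
  (integrable_abse intf) fn_le.
have -> : [sequence (\int[lebesgue_measure]_x ((EFin \o f) \_ (D n)) x)%E]_n =
    (fun n : nat => (F n%:R - F (- n%:R))%:E).
  apply/funext => n /=; rewrite -integral_mkcond.
  (* For n = 0 the interval is a single point, and the fundamental theorem is applied only to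
     nondegenerate intervals. *)
  case: n => [|n].
    by rewrite /D oppr0 subrr set_itv1 integral_set1.
  rewrite (@continuous_FTC2 R f F)//.
  - by rewrite gtrN// ltr0n.
  - exact: continuous_subspaceT.
  - split.
    + by move=> x _; exact: ex_derive.
    + apply: cvg_at_right_filter; apply: differentiable_continuous.
      by apply/derivable1_diffP; exact: ex_derive.
    + apply: cvg_at_left_filter; apply: differentiable_continuous.
      by apply/derivable1_diffP; exact: ex_derive.
  - by move=> x _; rewrite derive1E derive_val.
move=> cv; rewrite /Rintegral.
suff -> : (\int[lebesgue_measure]_x (f x)%:E)%E = 0%E by [].
apply: (cvg_unique _ cv).
  exact: ereal_hausdorff.
apply/fine_cvgP; split; first exact: nearW.
by rewrite -[X in _ --> X](subr0 0); exact: cvgB.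
Unshelve. all: by end_near. Qed.

Lemma continuous_power_gauss (R : realType) (k : nat) :
  continuous (fun t : R => t ^+ k * expR (- (t ^+ 2) / 2)).
Proof.
move=> x; apply: cvgM; first exact: exprn_continuous.
apply: (cvg_comp _ expR); last exact: continuous_expR.
apply: cvgM; last exact: cvg_cst.
by apply: cvgN; exact: exprn_continuous.
Qed.

Lemma is_derive_gauss (R : realType) (x : R) :
  is_derive x (1 : R) (fun t => expR (- (t ^+ 2) / 2)) (- (x * expR (- (x ^+ 2) / 2))).
Proof.
apply: is_derive_eq.
rewrite /GRing.scale/=. 
by field.
Qed.

Lemma is_derive_power_gauss (R : realType) (k : nat) (x : R) :
  is_derive x (1 : R) (fun t => t ^+ k.+1 * expR (- (t ^+ 2) / 2))
    (k.+1%:R * (x ^+ k * expR (- (x ^+ 2) / 2)) - x ^+ k.+2 * expR (- (x ^+ 2) / 2)).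
Proof.
have H := is_derive_gauss x.
have Hk : is_derive x (1 : R) (fun t : R => t ^+ k.+1) (k.+1%:R * x ^+ k).
  apply: DeriveDef; first exact: exprn_derivable.
  by rewrite exp_derive /GRing.scale/= mulr1.
apply: (is_derive_eq (is_deriveM Hk H)).
by rewrite /GRing.scale/= !exprS; ring.
Qed.

(** Unnormalized: the factor 1/sqrt(2 pi) is restored in [std_normal_quartic]. *)
Definition gauss_moment (R : realType) (k : nat) : R :=
  Rintegral lebesgue_measure setT (fun t : R => t ^+ k * expR (- (t ^+ 2) / 2)).

Lemma gauss_moment0 (R : realType) : gauss_moment R 0 = Num.sqrt (2 * pi).
Proof.
have s1 : (1 : R) != 0 by [].
have := @integral_normal_pdf R 0 1; rewrite normal_pdfE// => /(congr1 fine)/=.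
have pk : normal_peak 1 = (Num.sqrt (2 * pi))^-1 :> R.
  by rewrite /normal_peak expr1n mul1r -mulr_natl.
rewrite pk.
have -> : (\int[lebesgue_measure]_x ((Num.sqrt (2 * pi))^-1 * normal_fun 0 1 x)%:E)%E
   = (\int[lebesgue_measure]_x ((Num.sqrt (2 * pi))^-1 * ((x : R) ^+ 0 * expR (- (x
     ^+ 2) / 2)))%:E)%E.
  apply: eq_integral => x _; congr (_ * _)%:E.
  by rewrite /normal_fun subr0 expr1n expr0 mul1r.
rewrite -/(Rintegral _ _ _) RintegralZl//; last exact: power_gauss_integrable.
rewrite -/(gauss_moment R 0) => H.
have p0 : Num.sqrt (2 * pi) != 0 :> R.
  by rewrite gt_eqF// sqrtr_gt0 mulr_gt0// pi_gt0.
by apply: (mulfI (invr_neq0 p0)); rewrite H mulVf.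
Qed.

Lemma gauss_moment1 (R : realType) : gauss_moment R 1 = 0.
Proof.
pose F (t : R) := - expR (- (t ^+ 2) / 2).
apply: (@Rintegral_derive_vanishing R _ F).
- exact: continuous_power_gauss.
- move=> x; have H := is_derive_gauss x; 
  by apply: (is_derive_eq (is_deriveN H)); rewrite opprK expr1.
- exact: power_gauss_integrable.
- rewrite -[X in _ --> X]oppr0; apply: cvgN.
  have := @power_gauss_cvg0 R 0 1 (expr1n _ _).
  by under eq_fun do rewrite expr0 !mul1r.
- rewrite -[X in _ --> X]oppr0; apply: cvgN.
  have := @power_gauss_cvg0 R 0 (-1) (sqrr_sign _ 1).
  by under eq_fun do rewrite expr0 mul1r mulN1r.
Qed.

(** The difference of the two sides is the integral of the derivative of t^(k+1) e^(-t^2/2), which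
    vanishes at both ends. *)
Lemma gauss_momentSS (R : realType) (k : nat) :
  gauss_moment R k.+2 = k.+1%:R * gauss_moment R k.
Proof.
have ik := power_gauss_integrable R k; have ikk := power_gauss_integrable R k.+2.
have izk : lebesgue_measure.-integrable [set: R]
    (EFin \o (fun t : R => k.+1%:R * (t ^+ k * expR (- (t ^+ 2) / 2)))).
  by have := integrableZl measurableT k.+1%:R ik; exact: eq_integrable.
apply/esym/eqP; rewrite -subr_eq0 /gauss_moment -RintegralZl// -RintegralB//.
apply/eqP; apply: (@Rintegral_derive_vanishing R _
  (fun t => t ^+ k.+1 * expR (- (t ^+ 2) / 2))).
- move=> x; apply: cvgB; last exact: continuous_power_gauss.
  by apply: cvgM; [exact: cvg_cst|exact: continuous_power_gauss].
- exact: is_derive_power_gauss.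
- have := integrableB measurableT izk ikk; exact: eq_integrable.
- have := @power_gauss_cvg0 R k.+1 1 (expr1n _ _).
  by under eq_fun do rewrite mul1r.
- have := @power_gauss_cvg0 R k.+1 (-1) (sqrr_sign _ 1).
  by under eq_fun do rewrite mulN1r.
Qed.

(** The moments of orders 0 to 4 are 1, 0, 1, 0, 3. Degree four suffices because the loss is the
    expectation of a squared quadratic polynomial. *)
Lemma std_normal_quartic (R : realType) (p0 p1 p2 p3 p4 : R) (f : R -> R) :
  (forall t, f t = p0 + p1 * t + p2 * t ^+ 2 + p3 * t ^+ 3 + p4 * t ^+ 4) ->
  Rintegral lebesgue_measure setT (fun t => std_normal_pdf t * f t)
    = p0 + p2 + 3 * p4.
Proof.
move=> fE; pose s : R := (Num.sqrt (2 * pi))^-1.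
have s0 : s * Num.sqrt (2 * pi) = 1.
  by rewrite mulVf// gt_eqF// sqrtr_gt0 mulr_gt0// pi_gt0.
pose e k := fun t : R => t ^+ k * expR (- (t ^+ 2) / 2).
have ie k c : lebesgue_measure.-integrable [set: R] (EFin \o (fun t => c * e k t)).
  by have := integrableZl measurableT c (power_gauss_integrable R k);
    exact: eq_integrable.
have iD (f1 f2 : R -> R) : lebesgue_measure.-integrable [set: R] (EFin \o f1) ->
    lebesgue_measure.-integrable [set: R] (EFin \o f2) ->
    lebesgue_measure.-integrable [set: R] (EFin \o (fun t => f1 t + f2 t)).
  by move=> i1 i2; have := integrableD measurableT i1 i2; exact: eq_integrable.
under eq_Rintegral => t _.
  rewrite (_ : _ * _ = s * p0 * e 0%N t + s * p1 * e 1%N t + s * p2 * e 2%N t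
     + s * p3 * e 3%N t + s * p4 * e 4%N t); last first.
    by rewrite fE /std_normal_pdf /e -/s; ring.
  over.
have eM k c : Rintegral lebesgue_measure setT (fun t => c * e k t) =
  c * gauss_moment R k.
  by rewrite RintegralZl//; exact: power_gauss_integrable.
rewrite !RintegralD//; do ?by do ?[exact: ie|apply: (iD)].
rewrite !eM !gauss_momentSS gauss_moment1 gauss_moment0 !mulr0 addr0.
transitivity ((p0 + p2 + 3 * p4) * (s * Num.sqrt (2 * pi))); first by ring.
by rewrite s0 mulr1.
Qed.

(** * The loss in closed form and its gradient *)

(* Conditioning on the first coordinate t leaves a quadratic polynomial in the others,
   with linear coefficients l_{i+1} + 2 t B_{0,i+1}. *)
Lemma gauss_exp_sqr_quadratic (R : realType) (n : nat) (B : nat -> nat -> R)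
    (l : nat -> R) (c : R) : (forall i j, B i j = B j i) ->
  gauss_exp n (fun z => (\sum_(i < n) \sum_(j < n) B i j * (z i * z j)
                         + \sum_(i < n) l i * z i + c) ^+ 2)
  = 2 * (\sum_(i < n) \sum_(j < n) B i j ^+ 2) + \sum_(i < n) l i ^+ 2
    + (c + \sum_(i < n) B i i) ^+ 2.
Proof.
elim: n B l c => [|n IH] B l c Bsym.
  by rewrite /= !big_ord0 mulr0 !add0r addr0.
pose B' i j := B i.+1 j.+1.
pose tr' := \sum_(i < n) B' i i.
pose sB := \sum_(i < n) B 0%N i.+1 ^+ 2.
pose sl := \sum_(i < n) l i.+1 ^+ 2.
pose slB := \sum_(i < n) l i.+1 * B 0%N i.+1.
pose sBB := \sum_(i < n) \sum_(j < n) B' i j ^+ 2.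
rewrite [LHS]/=.
(* The five arguments are the coefficients in t of 2 [sBB] + |l' + 2 t B_0|^2 + (c + tr' + l_0 t +
   B_00 t^2)^2, the value that the induction hypothesis gives once the first coordinate is fixed at
   t. *)
rewrite (@std_normal_quartic R (2 * sBB + sl + (c + tr') ^+ 2)
  (4 * slB + 2 * (c + tr') * l 0%N)
  (4 * sB + l 0%N ^+ 2 + 2 * (c + tr') * B 0%N 0%N) (2 * l 0%N * B 0%N 0%N)
  (B 0%N 0%N ^+ 2)).
- rewrite !big_ord_recl.
  under [X in _ = 2 * (_ + X) + _ + _]eq_bigr => i _ do
    rewrite big_ord_recl /= /bump /= add1n Bsym.
  rewrite big_split /=.
  rewrite -/sB -/tr' -/sl; under eq_bigr do under eq_bigr do rewrite /bump /= add1n.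
  rewrite -/sBB. ring.
- move=> t.
  transitivity (gauss_exp n (fun z => (\sum_(i < n) \sum_(j < n) B' i j * (z i * z j)
     + \sum_(i < n) (l i.+1 + 2 * t * B 0%N i.+1) * z i
     + (c + l 0%N * t + B 0%N 0%N * t ^+ 2)) ^+ 2)).
    congr gauss_exp; apply/funext => z; congr (_ ^+ 2).
    rewrite !big_ord_recl.
    under [X in _ + X + _ + _ = _]eq_bigr => i _ do
      rewrite big_ord_recl /= /bump /= add1n Bsym.
    rewrite big_split /=.
    have -> : \sum_(i < n) B 0%N (lift ord0 i) * (t * z i) =
      t * \sum_(i < n) B 0%N i.+1 * z i.
      by rewrite mulr_sumr; apply: eq_bigr => i _; rewrite /= mulrCA.
    have -> : \sum_(i < n) B 0%N i.+1 * (z i * t) = t * \sum_(i < n) B 0%N i.+1 * z i.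
      by rewrite mulr_sumr; apply: eq_bigr => i _; rewrite mulrA mulrC.
    have -> : \sum_(i < n) (l i.+1 + 2 * t * B 0%N i.+1) * z i =
       \sum_(i < n) l i.+1 * z i + 2 * t * \sum_(i < n) B 0%N i.+1 * z i.
      by rewrite mulr_sumr -big_split; apply: eq_bigr => i _; rewrite mulrDl mulrA.
    rewrite /=; ring.
  rewrite (IH B' (fun i => l i.+1 + 2 * t * B 0%N i.+1)); last by move=> i j;
    exact: Bsym.
  rewrite -/sBB -/tr'.
  have -> : \sum_(i < n) (l i.+1 + 2 * t * B 0%N i.+1) ^+ 2 =
    sl + 4 * t * slB + 4 * t ^+ 2 * sB.
    rewrite /sl /slB /sB !mulr_sumr -!big_split; apply: eq_bigr => i _ /=; ring.
  ring.
Qed.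

(** The noise is the Gaussian coordinate of index [d]: [A] is padded with a zero row and column
    there, and [sigma] becomes the linear coefficient of that coordinate, all other linear
    coefficients being 0. *)
Lemma gauss_exp_sqr_form (R : realType) (d : nat) (A : 'M[R]_d) (sigma : R) :
  A^T = A ->
  gauss_exp d.+1 (fun z => (((\col_(i < d) z i)^T *m A *m (\col_(i < d) z i)) 0 0
                            + sigma * z d) ^+ 2)
  = 2 * \tr (A *m A) + sigma ^+ 2 + (\tr A) ^+ 2.
Proof.
move=> Asym.
pose B (i j : nat) : R := if (insub i : option 'I_d, insub j : option 'I_d)
  is (Some i', Some j') then A i' j' else 0.
have Bsym i j : B i j = B j i.
  by rewrite /B; case: insubP => [i' _ _|_]; case: insubP => [j' _ _|_] //;
    rewrite -{1}Asym mxE.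
have BE (i j : 'I_d) : B i j = A i j by rewrite /B !valK.
have Bd1 i : B d i = 0 by rewrite /B insubF ?ltnn.
have Bd2 i : B i d = 0 by rewrite Bsym Bd1.
pose l (i : nat) : R := if i == d then sigma else 0.
have lE (i : 'I_d) : l i = 0 by rewrite /l ltn_eqF.
transitivity (gauss_exp d.+1 (fun z => (\sum_(i < d.+1) \sum_(j < d.+1) B i j * (z
  i * z j)
                         + \sum_(i < d.+1) l i * z i + 0) ^+ 2)).
  congr gauss_exp; apply/funext => z; congr (_ ^+ 2); rewrite addr0; congr (_ + _).
    rewrite big_ord_recr /= [X in _ + X]big1 ?addr0; last by move=> j _;
      rewrite Bd1 mul0r.
    under [RHS]eq_bigr => i _ do rewrite big_ord_recr /= Bd2 mul0r addr0.
    rewrite exchange_big mxE /=; apply: eq_bigr => j _; rewrite !mxE mulr_suml.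
    by apply: eq_bigr => i _; rewrite BE !mxE mulrAC mulrC.
  by rewrite big_ord_recr /= big1 ?add0r /l ?eqxx// => i _; rewrite ltn_eqF ?mul0r.
rewrite (@gauss_exp_sqr_quadratic R d.+1 B l 0 Bsym); congr (_ + _ + _ ^+ 2).
- congr (2 * _).
  rewrite big_ord_recr /= [X in _ + X]big1 ?addr0; last by move=> j _;
    rewrite Bd1 expr0n.
  rewrite /mxtrace; apply: eq_bigr => i _; rewrite big_ord_recr /= Bd2 expr0n addr0 mxE.
  by apply: eq_bigr => j _; rewrite BE expr2 -{2}Asym mxE.
- by rewrite big_ord_recr /= big1 ?add0r /l ?eqxx// => i _; rewrite ltn_eqF ?expr0n.
- rewrite add0r big_ord_recr /= Bd1 addr0 /mxtrace; apply: eq_bigr => i _; exact: BE.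
Qed.

Lemma derive1_quartic (R : realType) (p0 p1 p2 p3 p4 : R) (f : R -> R) :
  (forall t, f t = p0 + p1 * t + p2 * t ^+ 2 + p3 * t ^+ 3 + p4 * t ^+ 4) ->
  derive1 f 0 = p1.
Proof.
move=> fE; pose p := Poly [:: p0; p1; p2; p3; p4].
have -> : f = horner p.
  apply/funext => t; rewrite fE horner_Poly /=; ring.
rewrite -derivE horner_coef0 coef_deriv coef_Poly /=; ring.
Qed.

(** With x = S z and S^2 = Q, the residual is the quadratic form of S D S in z plus the noise;
    cyclicity of the trace then replaces S D S by D Q. *)
Lemma loss_trace (R : realType) (d : nat) (Q : 'M[R]_d) (wstar : 'cV[R]_d)
    (sigma : R) (W : 'M[R]_d) :
  (exists Y, psd Y /\ Y *m Y = Q) ->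
  let D := wstar *m wstar^T - W *m W^T in
  loss Q wstar sigma W =
    2 * \tr (D *m Q *m (D *m Q)) + sigma ^+ 2 + (\tr (D *m Q)) ^+ 2.
Proof.
move=> [Y0 hY0] D; rewrite /loss.
have : [set Y | psd Y /\ Y *m Y = Q] (psd_sqrt Q) by apply: xgetPex; exists Y0.
move: (psd_sqrt Q) => S [[Ssym _] SQ].
have Dsym : D^T = D by rewrite /D linearB /= !trmx_mul !trmxK.
have Asym : (S *m D *m S)^T = S *m D *m S by rewrite !trmx_mul Ssym Dsym mulmxA.
have := @gauss_exp_sqr_form R d (S *m D *m S) sigma Asym.
have -> : \tr (S *m D *m S *m (S *m D *m S)) = \tr (D *m Q *m (D *m Q)).
  by rewrite -!mulmxA mxtrace_mulC -SQ !mulmxA.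
have -> : \tr (S *m D *m S) = \tr (D *m Q) by rewrite -mulmxA mxtrace_mulC -mulmxA SQ.
move=> <-; congr gauss_exp; apply/funext => z /=; congr (_ ^+ 2).
rewrite addrAC; congr (_ + _).
set u := \col_i z i.
have sqE (y : 'cV[R]_d) : ((y^T *m (S *m u)) 0 0) ^+ 2 =
    ((S *m u)^T *m (y *m y^T) *m (S *m u)) 0 0.
  have -> : (S *m u)^T *m (y *m y^T) *m (S *m u) =
      (y^T *m (S *m u))^T *m (y^T *m (S *m u))
        by rewrite [(y^T *m _)^T]trmx_mul trmxK !mulmxA.
  by rewrite [RHS]mxE big_ord1 [X in _ = X * _]mxE expr2.
have -> : (S *m u)^T *m wstar = (wstar^T *m (S *m u))^T
  by rewrite [(wstar^T *m _)^T]trmx_mul trmxK.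
rewrite [X in X ^+ 2]mxE sqE.
have -> : \sum_(j < d) ((col j W)^T *m (S *m u)) 0 0 ^+ 2 =
    ((S *m u)^T *m (W *m W^T) *m (S *m u)) 0 0.
  have -> : (S *m u)^T *m (W *m W^T) *m (S *m u) =
      (W^T *m (S *m u))^T *m (W^T *m (S *m u))
        by rewrite [(W^T *m _)^T]trmx_mul trmxK !mulmxA.
  rewrite [RHS]mxE; apply: eq_bigr => j _; rewrite [X in _ = X * _]mxE -expr2;
    congr (_ ^+ 2).
  by rewrite tr_col -row_mul mxE.
have -> : u^T *m (S *m D *m S) *m u = (S *m u)^T *m D *m (S *m u).
  by rewrite trmx_mul Ssym !mulmxA.
by rewrite /D mulmxBr mulmxBl [RHS]mxE [X in _ = _ + X]mxE.
Qed.

(** Along W + t H with H a unit matrix, D Q becomes X - t Y - t^2 Z, so the loss is a quartic in t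
    and the partial derivative is its linear coefficient. *)
Lemma gradW_loss (R : realType) (d : nat) (Q : 'M[R]_d) (wstar : 'cV[R]_d)
    (sigma : R) (W : 'M[R]_d) :
  (exists Y, psd Y /\ Y *m Y = Q) -> Q^T = Q ->
  let D := wstar *m wstar^T - W *m W^T in
  gradW (loss Q wstar sigma) W =
    - 4 *: ((2 *: (Q *m D *m Q) + \tr (D *m Q) *: Q) *m W).
Proof.
move=> hQ Qsym D; apply/matrixP => i j; rewrite mxE.
have Dsym : D^T = D by rewrite /D linearB /= !trmx_mul !trmxK.
have trN (A : 'M[R]_d) : \tr (- A) = - \tr A by rewrite linearN.
pose H : 'M[R]_d := delta_mx i j.
pose X := D *m Q; pose Y := (H *m W^T + W *m H^T) *m Q; pose Z := H *m H^T *m Q.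
rewrite (@derive1_quartic R (2 * \tr (X *m X) + sigma ^+ 2 + (\tr X) ^+ 2)
  (- 4 * \tr (X *m Y) - 2 * \tr X * \tr Y)
  (2 * (\tr (Y *m Y) - 2 * \tr (X *m Z)) + (\tr Y) ^+ 2 - 2 * \tr X * \tr Z)
  (4 * \tr (Y *m Z) + 2 * \tr Y * \tr Z)
  (2 * \tr (Z *m Z) + (\tr Z) ^+ 2)); last first.
  move=> t; rewrite loss_trace//.
  have -> : (wstar *m wstar^T - (W + t *: delta_mx i j) *m (W + t *: delta_mx i
    j)^T) *m Q
      = X - t *: Y - t ^+ 2 *: Z.
    have -> : (W + t *: delta_mx i j) *m (W + t *: delta_mx i j)^T =
        W *m W^T + t *: (H *m W^T + W *m H^T) + t ^+ 2 *: (H *m H^T).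
      rewrite -/H linearD linearZ /= mulmxDl !mulmxDr -!scalemxAl -!scalemxAr.
      by rewrite scalerA -expr2 scalerDr !addrA -[in RHS](addrA (W *m W^T)) [X in _
        = _ + X + _]addrC !addrA.
    by rewrite /X /Y /Z /D !opprD !addrA mulmxBl mulmxBl -!scalemxAl.
  have trC : \tr ((X - t *: Y - t ^+ 2 *: Z) *m (X - t *: Y - t ^+ 2 *: Z))
    = \tr (X *m X) - 2 * t * \tr (X *m Y) + t ^+ 2 * (\tr (Y *m Y) - 2 * \tr (X *m Z))
      + 2 * t ^+ 3 * \tr (Y *m Z) + t ^+ 4 * \tr (Z *m Z).
    rewrite !(mulmxDl, mulmxDr, mulmxN, mulNmx) -!scalemxAl -!scalemxAr.
    rewrite !(mxtraceD, trN, mxtraceZ).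
    rewrite (mxtrace_mulC Y X) (mxtrace_mulC Z X) (mxtrace_mulC Z Y); ring.
  rewrite trC !(mxtraceD, trN, mxtraceZ); ring.
(* Pairing with H reads off the (i, j) entry; the symmetry of D and Q makes the two halves of Y
   contribute equally. *)
have trH (G : 'M[R]_d) : \tr (H^T *m G) = G i j.
  rewrite /mxtrace (bigD1 j)//= [X in _ + X]big1 ?addr0 => [|k kj].
    rewrite mxE (bigD1 i)//= big1 ?addr0 => [|l li]; first by rewrite !mxE !eqxx mul1r.
    by rewrite !mxE (negPf li) mul0r.
  by rewrite mxE big1// => l _; rewrite !mxE (negPf kj) andbF mul0r.
have E1 : \tr (X *m Y) = 2 * (Q *m D *m Q *m W) i j.
  rewrite -trH /X /Y mulmxDl mulmxDr mxtraceD.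
  have -> : \tr (D *m Q *m (H *m W^T *m Q)) = \tr (H^T *m (Q *m D *m Q *m W)).
    rewrite -mxtrace_tr !trmx_mul trmxK Dsym Qsym -!mulmxA mxtrace_mulC -!mulmxA.
    by rewrite mxtrace_mulC -!mulmxA mxtrace_mulC -!mulmxA.
  have -> : \tr (D *m Q *m (W *m H^T *m Q)) = \tr (H^T *m (Q *m D *m Q *m W)).
    by rewrite -!mulmxA mxtrace_mulC -!mulmxA mxtrace_mulC -!mulmxA mxtrace_mulC
      -!mulmxA.
  ring.
have E2 : \tr Y = 2 * (Q *m W) i j.
  rewrite -trH /Y mulmxDl mxtraceD.
  have -> : \tr (H *m W^T *m Q) = \tr (H^T *m (Q *m W)).
    by rewrite -mxtrace_tr !trmx_mul trmxK Qsym mxtrace_mulC -!mulmxA mxtrace_mulC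
      -!mulmxA.
  have -> : \tr (W *m H^T *m Q) = \tr (H^T *m (Q *m W)).
    by rewrite -!mulmxA mxtrace_mulC -!mulmxA.
  ring.
rewrite E1 E2 mulmxDl -!scalemxAl [RHS]mxE [X in _ = _ * X]mxE !mxE -/X; ring.
Qed.

(** * Uniqueness of positive semidefinite square roots and of Moore-Penrose inverses *)

Lemma dotmx_ge0 (R : realType) (n : nat) (u : 'cV[R]_n) : 0 <= (u^T *m u) 0 0.
Proof. by rewrite mxE sumr_ge0// => i _; rewrite mxE -expr2 sqr_ge0. Qed.

Lemma dotmx_eq0 (R : realType) (n : nat) (u : 'cV[R]_n) :
  (u^T *m u) 0 0 = 0 -> u = 0.
Proof.
rewrite mxE => /eqP; rewrite psumr_eq0 => [/allP h|i _];
  last by rewrite mxE -expr2 sqr_ge0.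
apply/colP => i; have := h i (mem_index_enum i); rewrite !mxE mulf_eq0 orbb.
by move/eqP.
Qed.

(** If x > 0, the value at t = -x/(y+1) is negative; the added 1 keeps the denominator positive when
    y = 0. *)
Lemma quadratic_ge0_lin0 (R : realType) (x y : R) : 0 <= x -> 0 <= y ->
  (forall t, 0 <= 2 * t * x + t ^+ 2 * y) -> x = 0.
Proof.
move=> x0 y0 H; apply/eqP/negPn/negP => xn0.
have xp : 0 < x by rewrite lt_neqAle eq_sym xn0.
have yp : 0 < y + 1 by lra.
have := H (- x / (y + 1)).
have -> : 2 * (- x / (y + 1)) * x + (- x / (y + 1)) ^+ 2 * y =
    - (x ^+ 2 * (y + 2) / (y + 1) ^+ 2) by field; rewrite gt_eqF.
by rewrite oppr_ge0 leNgt divr_gt0// ?exprn_gt0// mulr_gt0 ?exprn_gt0//; lra.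
Qed.

(* Positivity of the form along u + t * S u for t < 0 forces S u = 0. *)
Lemma psd_form0 (R : realType) (n : nat) (S : 'M[R]_n) (u : 'cV[R]_n) :
  psd S -> (u^T *m S *m u) 0 0 = 0 -> S *m u = 0.
Proof.
move=> [Ssym Spos] u0; apply: dotmx_eq0.
set x := ((S *m u)^T *m (S *m u)) 0 0.
pose y := ((S *m u)^T *m S *m (S *m u)) 0 0.
have x0 : 0 <= x by exact: dotmx_ge0.
have y0 : 0 <= y by exact: Spos.
have H t : 0 <= 2 * t * x + t ^+ 2 * y.
  have := Spos (u + t *: (S *m u)).
  have -> : (u + t *: (S *m u))^T = u^T + t *: (S *m u)^T by rewrite linearD linearZ.
  have e1 : u^T *m S = (S *m u)^T by rewrite trmx_mul Ssym.
  have -> : (u^T + t *: (S *m u)^T) *m S *m (u + t *: (S *m u)) =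
      u^T *m S *m u + (2 * t) *: ((S *m u)^T *m (S *m u))
      + t ^+ 2 *: ((S *m u)^T *m S *m (S *m u)).
    rewrite !(mulmxDl, mulmxDr) -!scalemxAl -!scalemxAr scalerA -expr2.
    rewrite -e1 -!mulmxA -!addrA; congr (_ + _); rewrite !addrA; congr (_ + _).
    by rewrite -scalerDl; congr (_ *: _); ring.
  by rewrite 2!mxE u0 add0r mxE [X in _ + X]mxE.
exact: (quadratic_ge0_lin0 x0 y0 H).
Qed.

(** The diagonal entries of D^T S D are the values of the form S on the columns of D. If they sum to
    0, each is 0 and [psd_form0] applies to every column. *)
Lemma psd_trace0 (R : realType) (n : nat) (S D : 'M[R]_n) :
  psd S -> 0 <= \tr (D^T *m S *m D) /\ (\tr (D^T *m S *m D) = 0 -> S *m D = 0).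
Proof.
move=> Spsd.
have diagE i : (D^T *m S *m D) i i = ((col i D)^T *m S *m col i D) 0 0.
  rewrite tr_col -row_mul [LHS]mxE [RHS]mxE; apply: eq_bigr => j _.
  by congr (_ * _); rewrite [RHS]mxE.
have h0 i : 0 <= (D^T *m S *m D) i i by rewrite diagE; exact: Spsd.2.
split; first by apply: sumr_ge0 => i _.
move/eqP; rewrite psumr_eq0 => // /allP h.
apply/matrixP => i j; have /eqP := h j (mem_index_enum j); rewrite diagE.
move/(psd_form0 Spsd) => /colP/(_ i); rewrite !mxE => Sj.
by rewrite -[RHS]Sj; apply: eq_bigr => k _; rewrite mxE.
Qed.

(* With D := Y - Z one has D Y + Z D = 0, so the two nonnegative traces
   tr (D Y D) and tr (D Z D) add up to 0. *)
Lemma psd_square_inj (R : realType) (n : nat) (Y Z : 'M[R]_n) :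
  psd Y -> psd Z -> Y *m Y = Z *m Z -> Y = Z.
Proof.
move=> pY pZ YZ; pose D := Y - Z.
have Dsym : D^T = D by rewrite /D linearB /= pY.1 pZ.1.
have DE : D *m Y + Z *m D = 0.
  by rewrite /D mulmxBl mulmxBr YZ addrA subrK subrr.
have [tY0 tY] := psd_trace0 D pY; have [tZ0 tZ] := psd_trace0 D pZ.
rewrite Dsym in tY0 tY tZ0 tZ.
have tr0 : \tr (D *m Y *m D) + \tr (D *m Z *m D) = 0.
  rewrite -[D *m Z *m D]mulmxA [X in _ + X]mxtrace_mulC -mxtraceD -mulmxDl DE mul0mx.
  exact: mxtrace0.
have YD : Y *m D = 0 by apply: tY; lra.
have ZD : Z *m D = 0 by apply: tZ; lra.
have DD : D^T *m D = 0 by rewrite Dsym {1}/D mulmxBl YD ZD subrr.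
apply/eqP; rewrite -subr_eq0 -/D; apply/eqP/matrixP => i j.
have : col j D = 0.
  apply: dotmx_eq0; have /matrixP/(_ j j) := DD; rewrite !mxE => Dj.
  by rewrite -[RHS]Dj; apply: eq_bigr => k _; rewrite !mxE.
by move/colP/(_ i); rewrite !mxE.
Qed.

(** Uniqueness pins down the choice made by [xget], so exhibiting a root computes [psd_sqrt]. *)
Lemma psd_sqrt_eq (R : realType) (n : nat) (S Y : 'M[R]_n) :
  psd Y -> Y *m Y = S -> psd_sqrt S = Y.
Proof.
move=> pY YS.
have : [set Y | psd Y /\ Y *m Y = S] (psd_sqrt S) by apply: xgetPex; exists Y.
by move=> [pS SS]; apply: psd_square_inj => //; rewrite SS.
Qed.

(** Penrose's argument: for two candidates X and Y the projections satisfy S X = S Y and X S = Y S,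
    whence X = X S X = Y S Y = Y. *)
Lemma mp_pinv_eq (R : realType) (n : nat) (S X : 'M[R]_n) :
  S *m X *m S = S -> X *m S *m X = X -> (S *m X)^T = S *m X ->
  (X *m S)^T = X *m S -> mp_pinv S = X.
Proof.
move=> h1 h2 h3 h4.
have : [set X | S *m X *m S = S /\ X *m S *m X = X /\
  (S *m X)^T = S *m X /\ (X *m S)^T = X *m S] (mp_pinv S).
  by apply: xgetPex; exists X.
move: (mp_pinv S) => Y [k1 [k2 [k3 k4]]].
have SE : S *m X = S *m Y.
  rewrite -{1}k1 -mulmxA -k3 -h3 -trmx_mul.
  by rewrite mulmxA h1 k3.
have ES : X *m S = Y *m S.
  rewrite -{1}k1 -(mulmxA S) mulmxA -h4 -k4 -trmx_mul.
  by rewrite -[Y *m S *m _]mulmxA [S *m (X *m S)]mulmxA h1 k4.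
by rewrite -h2 ES -mulmxA SE mulmxA k2.
Qed.

(** * The commutative algebra spanned by the projections onto w, v and their orthogonal
    complement *)

Section Frame.
Variables (R : realType) (d : nat) (w v : 'cV[R]_d).
Hypotheses (ww : w^T *m w = 1%:M) (vv : v^T *m v = 1%:M) (vw : v^T *m w = 0).

(** For orthonormal w and v, the parameters are the eigenvalues on w, on v and on the complement, so
    products and polar factors are computed coordinatewise. *)
Definition frame_mx (a b c : R) : 'M[R]_d :=
  a *: (w *m w^T) + b *: (v *m v^T) + c *: (1%:M - w *m w^T - v *m v^T).

Let P := 1%:M - w *m w^T - v *m v^T.

Let wv : w^T *m v = 0.
Proof. by rewrite -[LHS]trmxK trmx_mul trmxK vw trmx0. Qed.

Let pp : (w *m w^T) *m (w *m w^T) = w *m w^T.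
Proof. by rewrite mulmxA -(mulmxA w) ww mulmx1. Qed.
Let qq : (v *m v^T) *m (v *m v^T) = v *m v^T.
Proof. by rewrite mulmxA -(mulmxA v) vv mulmx1. Qed.
Let pq : (w *m w^T) *m (v *m v^T) = 0.
Proof. by rewrite mulmxA -(mulmxA w) wv mulmx0 mul0mx. Qed.
Let qp : (v *m v^T) *m (w *m w^T) = 0.
Proof. by rewrite mulmxA -(mulmxA v) vw mulmx0 mul0mx. Qed.
Let pP : (w *m w^T) *m P = 0.
Proof. by rewrite /P !mulmxBr mulmx1 pp pq subrr subr0. Qed.
Let qP : (v *m v^T) *m P = 0.
Proof. by rewrite /P !mulmxBr mulmx1 qq qp subr0 subrr. Qed.
Let Pp : P *m (w *m w^T) = 0.
Proof. by rewrite /P !mulmxBl mul1mx pp qp subrr subr0. Qed.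
Let Pq : P *m (v *m v^T) = 0.
Proof. by rewrite /P !mulmxBl mul1mx qq pq subr0 subrr. Qed.
Let PP : P *m P = P.
Proof. by rewrite {1}/P !mulmxBl mul1mx pP qP !subr0. Qed.

Lemma frame_mxM a b c a' b' c' :
  frame_mx a b c *m frame_mx a' b' c' = frame_mx (a * a') (b * b') (c * c').
Proof.
rewrite /frame_mx -/P !(mulmxDl, mulmxDr) -!scalemxAl -!scalemxAr.
by rewrite pp qq pq qp pP qP Pp Pq PP !scaler0 !addr0 !add0r !scalerA.
Qed.

Lemma frame_mxD a b c a' b' c' :
  frame_mx a b c + frame_mx a' b' c' = frame_mx (a + a') (b + b') (c + c').
Proof. by rewrite /frame_mx !scalerDl addrACA [X in X + _ = _]addrACA. Qed.

Lemma frame_mxZ k a b c : k *: frame_mx a b c = frame_mx (k * a) (k * b) (k * c).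
Proof. by rewrite /frame_mx !scalerDr !scalerA. Qed.

Lemma frame_mxN a b c : - frame_mx a b c = frame_mx (- a) (- b) (- c).
Proof. by rewrite -scaleN1r frame_mxZ !mulN1r. Qed.

Lemma frame_mx_scalar a : frame_mx a a a = a%:M.
Proof.
rewrite /frame_mx -!scalerDr -[RHS]scalemx1; congr (_ *: _).
by rewrite addrC -[X in X + _]addrA -opprD subrK.
Qed.

Lemma tr_frame_mx a b c : (frame_mx a b c)^T = frame_mx a b c.
Proof.
have trp (x : 'cV[R]_d) : (x *m x^T)^T = x *m x^T by rewrite trmx_mul trmxK.
have trD (X Y : 'M[R]_d) : (X + Y)^T = X^T + Y^T by rewrite linearD.
have trZ k (X : 'M[R]_d) : (k *: X)^T = k *: X^T by rewrite linearZ.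
have trN (X : 'M[R]_d) : (- X)^T = - X^T by rewrite linearN.
by rewrite /frame_mx !(trD, trZ, trN) !trp trmx1.
Qed.

Lemma mxtrace_frame_mx a b c :
  \tr (frame_mx a b c) = a + b + (d%:R - 2) * c.
Proof.
have trN (X : 'M[R]_d) : \tr (- X) = - \tr X by rewrite linearN.
rewrite /frame_mx !(mxtraceD, mxtraceZ, trN).
rewrite mxtrace1 (mxtrace_mulC w) (mxtrace_mulC v) ww vv mxtrace1; ring.
Qed.

Lemma psd_conj_frame_mx (U : 'M[R]_d) a b c :
  0 <= a -> 0 <= b -> 0 <= c -> psd (U^T *m frame_mx a b c *m U).
Proof.
move=> a0 b0 c0; split; first by rewrite !trmx_mul trmxK tr_frame_mx mulmxA.
move=> u; pose y := frame_mx (Num.sqrt a) (Num.sqrt b) (Num.sqrt c) *m U *m u.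
have -> : u^T *m (U^T *m frame_mx a b c *m U) *m u = y^T *m y.
  rewrite /y !trmx_mul tr_frame_mx !mulmxA; congr (_ *m _ *m _).
  by rewrite -[RHS]mulmxA frame_mxM -!expr2 !sqr_sqrtr.
exact: dotmx_ge0.
Qed.

Lemma psd_sqrt_frame_ex a b c : 0 <= a -> 0 <= b -> 0 <= c ->
  exists Y, psd Y /\ Y *m Y = frame_mx a b c.
Proof.
move=> a0 b0 c0; exists (frame_mx (Num.sqrt a) (Num.sqrt b) (Num.sqrt c)); split.
  have := @psd_conj_frame_mx 1%:M _ _ _ (sqrtr_ge0 a) (sqrtr_ge0 b) (sqrtr_ge0 c).
  by rewrite trmx1 mul1mx mulmx1.
by rewrite frame_mxM -!expr2 !sqr_sqrtr.
Qed.

(** The Gram matrix is U^T F U with F having eigenvalues a^2, b^2, c^2. Its pseudo-inverse square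
    root has eigenvalues 1/|a|, 1/|b|, 1/|c|, and a/|a| is the sign of a. The convention 0^-1 = 0
    agrees with the Moore-Penrose inverse on the kernel. *)
Lemma polar_frame_mx (U : 'M[R]_d) a b c : U *m U^T = 1%:M ->
  polar (frame_mx a b c *m U) = frame_mx (Num.sg a) (Num.sg b) (Num.sg c) *m U.
Proof.
move=> UU.
pose cj a b c := U^T *m frame_mx a b c *m U.
have cjM a1 b1 c1 a2 b2 c2 :
    cj a1 b1 c1 *m cj a2 b2 c2 = cj (a1 * a2) (b1 * b2) (c1 * c2).
  rewrite /cj -!mulmxA (mulmxA U) UU mul1mx (mulmxA (frame_mx a1 b1 c1)).
  by rewrite frame_mxM.
have cjT a1 b1 c1 : (cj a1 b1 c1)^T = cj a1 b1 c1.
  by rewrite /cj !trmx_mul trmxK tr_frame_mx mulmxA.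
have inv3 (x : R) : x * x^-1 * x = x.
  by have [->|x0] := eqVneq x 0; rewrite ?mulr0// mulfV// mul1r.
have inv3' (x : R) : x^-1 * x * x^-1 = x^-1 by rewrite -{2}(invrK x) inv3.
rewrite /polar.
have -> : (frame_mx a b c *m U)^T *m (frame_mx a b c *m U) =
    cj (a ^+ 2) (b ^+ 2) (c ^+ 2).
  by rewrite trmx_mul tr_frame_mx -!mulmxA (mulmxA (frame_mx a b c)) frame_mxM
    !mulmxA -!expr2.
rewrite (@mp_pinv_eq _ _ _ (cj (a ^+ 2)^-1 (b ^+ 2)^-1 (c ^+ 2)^-1)); last 4 first.
- by rewrite !cjM !inv3.
- by rewrite !cjM !inv3'.
- by rewrite cjM cjT.
- by rewrite cjM cjT.
rewrite (@psd_sqrt_eq _ _ _ (cj `|a|^-1 `|b|^-1 `|c|^-1)); last 2 first.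
- by apply: psd_conj_frame_mx; rewrite invr_ge0.
- by rewrite cjM -!invfM -!normrM -!expr2 !ger0_norm ?sqr_ge0.
rewrite /cj -!mulmxA (mulmxA U) UU mul1mx mulmxA frame_mxM.
have sgE (x : R) : x / `|x| = Num.sg x.
  have [->|x0] := eqVneq x 0; first by rewrite mul0r sgr0.
  by rewrite {1}[x]numEsg mulfK ?normr_eq0.
by rewrite !sgE.
Qed.

End Frame.

(** * The scalar sign dynamics of the three coordinates *)

Lemma sgr_cases (R : realType) (x : R) :
  [\/ 0 < x /\ Num.sg x = 1, x = 0 /\ Num.sg x = 0 | x < 0 /\ Num.sg x = -1].
Proof.
case: (ltrgt0P x) => [h|h|->]; [constructor 1|constructor 3|constructor 2].
- by rewrite gtr0_sg.
- by rewrite ltr0_sg.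
- by rewrite sgr0.
Qed.

(** The bound [K] is preserved by one step. Outward motion needs g > 0, hence L x^2 <= m before the
    step, and Young's inequality bounds the result. Otherwise x stays put or moves by eta towards 0:
    either |x| does not grow, or 0 is overshot and the new value is at most eta in modulus. *)
Lemma sg_step_bound (R : realType) (L eta g x m K : R) :
  0 <= L -> 0 < eta -> L * eta ^+ 2 <= K -> 5 / 4 * m + 5 * (L * eta ^+ 2) <= K ->
  L * x ^+ 2 <= K -> (0 < g -> L * x ^+ 2 <= m) ->
  L * (x + eta * Num.sg (g * x)) ^+ 2 <= K.
Proof.
move=> L0 e0 hK hm hx hg.
have [g0|g0] := ltP 0 g.
  have young s : s ^+ 2 <= 1 -> L * (x + eta * s) ^+ 2 <= K.
    move=> s1; apply: le_trans hm; have := hg g0.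
    (* Young's inequality in the form 2 x (eta s) <= x^2/4 + 4 (eta s)^2. *)
    have : (x + eta * s) ^+ 2 <= 5 / 4 * x ^+ 2 + 5 * eta ^+ 2.
      have e2 : eta ^+ 2 * s ^+ 2 <= eta ^+ 2 by rewrite ler_piMr ?sqr_ge0.
      have := sqr_ge0 (x / 2 - 2 * (eta * s)); rewrite !expr2 in e2 *; lra.
    move=> /(ler_wpM2l L0); lra.
  by apply: young; case: (sgr_cases (g * x)) => -[_ ->]; lra.
have gx : x * Num.sg (g * x) = 0 \/ x * Num.sg (g * x) =
  - `|x| /\ (Num.sg (g * x)) ^+ 2 = 1.
  rewrite sgrM; case: (sgr_cases g) => -[hg' ->]; first by lra.
    by left; rewrite mul0r mulr0.
  have [->|x0] := eqVneq x 0; first by left; rewrite mul0r.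
  right; split; last by rewrite mulN1r sqrrN sqr_sg x0.
  by rewrite mulN1r mulrN normrEsg mulrC.
case: gx => [x0|[xs s2]].
  have [->|xn0] := eqVneq x 0.
    by rewrite mulr0 sgr0 mulr0 addr0 expr0n /= mulr0 (le_trans _ hK)// mulr_ge0
      ?sqr_ge0.
  have /eqP -> : Num.sg (g * x) == 0 by move/eqP: x0; rewrite mulf_eq0 (negPf xn0).
  by rewrite mulr0 addr0.
have -> : (x + eta * Num.sg (g * x)) ^+ 2 = (`|x| - eta) ^+ 2.
  transitivity (x ^+ 2 + 2 * eta * (x * Num.sg (g * x)) + eta ^+ 2 * Num.sg (g * x)
    ^+ 2).
    ring.
  by rewrite xs s2 -(real_normK (num_real x)); ring.
have x0 := normr_ge0 x.
have [h|h] := leP eta `|x|.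
  apply: le_trans hx; rewrite ler_wpM2l// -(real_normK (num_real x)).
  by rewrite ler_sqr ?nnegrE; lra.
apply: le_trans hK; rewrite ler_wpM2l//.
have -> : (`|x| - eta) ^+ 2 = (eta - `|x|) ^+ 2 by ring.
by rewrite ler_sqr ?nnegrE; lra.
Qed.

Section SignDynamics.
Variables (R : realType) (n L eta theta : R) (al be ga : nat -> R).
Hypotheses (n5 : 5 <= n) (L1 : 1 <= L) (eta0 : 0 < eta) (theta0 : 0 < theta).
Hypotheses (Leta : L * eta ^+ 2 <= 1 / 100) (neta : n * eta ^+ 2 <= 1 / 100).
Hypothesis theta_small : theta ^+ 2 * (3 * L + n + 1) < 1.
Hypotheses (al0 : al 0%N = theta) (be0 : be 0%N = theta) (ga0 : ga 0%N = theta).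

Let s k := 1 - al k ^+ 2 - L * be k ^+ 2 - n * ga k ^+ 2.
Hypothesis alS : forall k,
  al k.+1 = al k + eta * Num.sg ((2 * (1 - al k ^+ 2) + s k) * al k).
Hypothesis beS : forall k,
  be k.+1 = be k + eta * Num.sg ((s k - 2 * L * be k ^+ 2) * be k).
Hypothesis gaS : forall k,
  ga k.+1 = ga k + eta * Num.sg ((s k - 2 * ga k ^+ 2) * ga k).

Local Ltac slra :=
  have := n5; have := L1; have := eta0; have := theta0; have := Leta;
  have := neta; have := theta_small; lra.

(** The common trajectory of all coordinates as long as every sign is +1. *)
Let x k := theta + k%:R * eta.

Let L0 : 0 <= L. Proof. slra. Qed.
Let n0 : 0 <= n. Proof. slra. Qed.

Let eta_small : eta <= 1 / 10.
Proof.
have h : eta ^+ 2 <= (1 / 10) ^+ 2.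
  apply: (@le_trans _ _ (L * eta ^+ 2)); last by slra.
  by rewrite ler_peMl ?sqr_ge0.
by rewrite -(@ler_sqr R) ?nnegrE//; slra.
Qed.

Let theta_lt : theta <= 1 / 3.
Proof.
have h : theta ^+ 2 * 9 <= theta ^+ 2 * (3 * L + n + 1).
  by rewrite ler_wpM2l ?sqr_ge0//; slra.
rewrite -(@ler_sqr R) ?nnegrE//; slra.
Qed.

Let x_gt0 k : 0 < x k.
Proof. by rewrite ltr_pwDl// mulr_ge0// ltW. Qed.

Let xS k : x k.+1 = x k + eta.
Proof. by rewrite /x -natr1; ring. Qed.

Let x_lt k : x k < x k.+1. Proof. rewrite xS; slra. Qed.

Let theta2 : 0 <= theta ^+ 2. Proof. exact: sqr_ge0. Qed.

(** Growth needs s > 2 L be^2, and s <= 1 - L be^2, so L be^2 <= 1/3 beforehand; then 5/4 * 1/3 +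
    5/100 < 1/2. *)
Lemma be_sqr_bound k : L * be k ^+ 2 <= 1 / 2.
Proof.
elim: k => [|k IH].
  have h1 : 0 <= theta ^+ 2 * L by rewrite mulr_ge0.
  have h2 : 0 <= theta ^+ 2 * n by rewrite mulr_ge0.
  by rewrite be0; have := theta2; slra.
rewrite beS; apply: (@sg_step_bound _ _ _ _ _ (1 / 3)) => //; try slra.
have := sqr_ge0 (al k); have : 0 <= n * ga k ^+ 2 by rewrite mulr_ge0 ?sqr_ge0.
by rewrite /s; slra.
Qed.

(** Here growth forces n ga^2 <= 1, and 5/4 + 5/100 < 3/2. *)
Lemma ga_sqr_bound k : n * ga k ^+ 2 <= 3 / 2.
Proof.
elim: k => [|k IH].
  have h1 : 0 <= theta ^+ 2 * L by rewrite mulr_ge0.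
  have h2 : 0 <= theta ^+ 2 * n by rewrite mulr_ge0.
  by rewrite ga0; have := theta2; slra.
rewrite gaS; apply: (@sg_step_bound _ _ _ _ _ 1) => //; try slra.
have := sqr_ge0 (al k); have : 0 <= L * be k ^+ 2 by rewrite mulr_ge0 ?sqr_ge0.
have := sqr_ge0 (ga k); by rewrite /s; slra.
Qed.

Let s_ge k : - 1 - al k ^+ 2 <= s k.
Proof. have := be_sqr_bound k; have := ga_sqr_bound k; rewrite /s; slra. Qed.

Let s_le k : s k <= 1 - al k ^+ 2.
Proof.
have : 0 <= L * be k ^+ 2 by rewrite mulr_ge0 ?sqr_ge0.
have : 0 <= n * ga k ^+ 2 by rewrite mulr_ge0 ?sqr_ge0.
by rewrite /s; slra.
Qed.

(** The bounds 1/2 and 3/2 on the other two terms give 2 (1 - al^2) + s >= 1 - 3 al^2. *)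
Lemma al_grow k : 0 < al k -> al k ^+ 2 < 1 / 3 -> al k.+1 = al k + eta.
Proof.
move=> a0 a3; rewrite alS gtr0_sg ?mulr1// mulr_gt0//.
by have := s_ge k; slra.
Qed.

(** A positive sign forces al < 1, so the step stays below 1 + 1/10. A negative sign forces al^2 >
    1/3, so al > 1/2 and the step stays above 1/2 - 1/10 = 2/5, which is where the condition on [m]
    comes from. *)
Lemma al_invariant m k : 0 < m -> m <= 2 / 5 -> m <= al k -> al k <= 2 ->
  m <= al k.+1 /\ al k.+1 <= 2.
Proof.
move=> m0 m3 ma a2; have a0 : 0 < al k by slra.
have := eta_small; have := s_le k; have := s_ge k => h1 h2 h3.
rewrite alS sgrM (gtr0_sg a0) mulr1.
case: (sgr_cases (2 * (1 - al k ^+ 2) + s k)) => -[hg ->].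
- have : al k ^+ 2 < 1 ^+ 2 by rewrite expr1n; slra.
  by rewrite ltr_sqr ?nnegrE//; [slra|slra].
- by rewrite mulr0 addr0; slra.
- have : (1 / 2) ^+ 2 < al k ^+ 2 by slra.
  by rewrite ltr_sqr ?nnegrE//; slra.
Qed.

Lemma al_range k : 0 < al k /\ al k <= 2.
Proof.
suff : theta <= al k /\ al k <= 2 by move=> [h1 h2]; split; slra.
elim: k => [|k [IH1 IH2]]; first by rewrite al0; have := theta_lt; slra.
by apply: al_invariant => //; have := theta_lt; slra.
Qed.

Lemma al_linear k : (forall j, (j < k)%N -> x j ^+ 2 < 1 / 3) -> al k = x k.
Proof.
elim: k => [|k IH] h; first by rewrite al0 /x mul0r addr0.
have alk : al k = x k by apply: IH => j jk; apply: h; rewrite ltnS ltnW.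
by rewrite xS -alk al_grow// ?alk// h.
Qed.

(** On the common trajectory the sign of be is that of 1 - x^2 (3L + n + 1). Since L >= 1, this is
    the first of the three factors that can fail to be positive. *)
Lemma lockstep k : (forall j, (j < k)%N -> x j ^+ 2 * (3 * L + n + 1) < 1) ->
  [/\ al k = x k, be k = x k & ga k = x k].
Proof.
elim: k => [|k IH] h.
  by rewrite al0 be0 ga0 /x mul0r addr0.
have [ak bk gk] : [/\ al k = x k, be k = x k & ga k = x k].
  by apply: IH => j jk; apply: h; rewrite ltnS ltnW.
have hk := h k (ltnSn k); have xk := x_gt0 k; have x2 := sqr_ge0 (x k).
have xL : x k ^+ 2 <= x k ^+ 2 * L by rewrite ler_peMr.
have xn : 0 <= x k ^+ 2 * n by rewrite mulr_ge0.
have hk' : 1 - (3 * (x k ^+ 2 * L) + x k ^+ 2 * n + x k ^+ 2) > 0 by slra.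
have sk : s k = 1 - x k ^+ 2 - x k ^+ 2 * L - x k ^+ 2 * n.
  by rewrite /s ak bk gk; ring.
rewrite alS beS gaS sk ak bk gk xS; split; rewrite gtr0_sg ?mulr1// mulr_gt0//; slra.
Qed.

(** T1 is the first index with x^2 (3L + n + 1) >= 1, where be stops growing, and T2 the first index
    from T1 on with x^2 >= delta. Both are at most [K] because x K >= 1, and x^2 < 1/3 before T2
    keeps al linear up to there. *)
Lemma sign_dynamics (delta : R) (K : nat) :
  0 < delta -> delta <= 1 / 9 -> 1 <= K%:R * eta -> exists T1 T2 : nat,
  be T1.+1 ^+ 2 <= be T1 ^+ 2 /\
  (forall k, (k < T1)%N -> be k ^+ 2 < be k.+1 ^+ 2) /\
  (T1 <= T2)%N /\ delta <= al T2 ^+ 2 /\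
  (forall k, (T1 <= k < T2)%N -> al k ^+ 2 < delta) /\
  (T2 <= K)%N /\
  (forall k, (k <= T2)%N -> al k = theta + k%:R * eta) /\
  (forall k, (T2 <= k)%N -> delta <= al k ^+ 2 <= 4).
Proof.
move=> delta0 delta9 K1; pose p1 k := 1 <= x k ^+ 2 * (3 * L + n + 1).
have xK : 1 <= x K ^+ 2.
  by rewrite -[leLHS](expr1n _ 2) ler_sqr ?nnegrE//; [rewrite /x; slra|exact: ltW].
have ex1 : exists k, p1 k.
  exists K; rewrite /p1; apply: (le_trans xK); rewrite ler_peMr ?sqr_ge0//; slra.
case: (ex_minnP ex1) => T1 pT1 minT1.
have T1K : (T1 <= K)%N.
  by apply: minT1; rewrite /p1; apply: (le_trans xK); rewrite ler_peMr ?sqr_ge0//; slra.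
have ltT1 j : (j < T1)%N -> x j ^+ 2 * (3 * L + n + 1) < 1.
  by move=> jT; rewrite ltNge; apply/negP => /minT1; rewrite leqNgt jT.
pose p2 k := (T1 <= k)%N && (delta <= x k ^+ 2).
have p2K : p2 K by rewrite /p2 T1K; slra.
have ex2 : exists k, p2 k by exists K.
case: (ex_minnP ex2) => T2 /andP[T12 dT2] minT2.
have T2K : (T2 <= K)%N by exact: minT2.
have ltT2 j : (j < T2)%N -> x j ^+ 2 < 1 / 3.
  move=> jT; have [jT1|T1j] := ltnP j T1.
    have := ltT1 j jT1.
    have : x j ^+ 2 * 3 <= x j ^+ 2 * (3 * L + n + 1)
      by rewrite ler_wpM2l ?sqr_ge0//; slra.
    slra.
  have : x j ^+ 2 < delta.
    by rewrite ltNge; apply/negP => h; have := minT2 j;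
      rewrite /p2 T1j h leqNgt jT => /(_ isT).
  slra.
have alx k : (k <= T2)%N -> al k = x k.
  by move=> kT; apply: al_linear => j jk; apply: ltT2; exact: leq_trans jk kT.
exists T1, T2; split; [|split; [|split; [|split; [|split; [|split; [|split]]]]]] => //.
- have [aT bT gT] : [/\ al T1 = x T1, be T1 = x T1 & ga T1 = x T1] by exact: lockstep.
  (* The small initialization excludes T1 = 0, so x T1 >= eta and a downward step does not cross 0;
     hence be^2 does not increase. *)
  have T1gt0 : (0 < T1)%N.
    rewrite lt0n; apply/eqP => T10; move: pT1; rewrite /p1 T10 /x mul0r addr0.
    by rewrite leNgt theta_small.
  have etax : eta <= x T1.
    have : 1 <= T1%:R :> R by rewrite ler1n.
    by move=> /(ler_wpM2r (ltW eta0)); rewrite /x; slra.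
  have sT : s T1 - 2 * L * be T1 ^+ 2 <= 0.
    by rewrite /s aT bT gT; move: pT1; rewrite /p1; slra.
  rewrite beS sgrM bT (gtr0_sg (x_gt0 T1)) mulr1 -bT.
  have be0' : be T1 = x T1 by [].
  case: (sgr_cases (s T1 - 2 * L * be T1 ^+ 2)) => -[hg ->].
  + slra.
  + by rewrite mulr0 addr0.
  + by rewrite bT ler_sqr ?nnegrE; slra.
- move=> k kT.
  have [_ -> _] : [/\ al k = x k, be k = x k & ga k = x k].
    by apply: lockstep => j jk; apply: ltT1; exact: ltn_trans jk kT.
  have [_ -> _] : [/\ al k.+1 = x k.+1, be k.+1 = x k.+1 & ga k.+1 = x k.+1].
    by apply: lockstep => j jk; apply: ltT1; exact: leq_trans jk kT.
  by rewrite ltr_sqr ?nnegrE ?x_lt// ltW.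
- by rewrite alx.
- move=> k /andP[T1k kT2]; rewrite (alx _ (ltnW kT2)).
  by rewrite ltNge; apply/negP => h; have := minT2 k;
    rewrite /p2 T1k h leqNgt kT2 => /(_ isT).
(* From T2 on, [al_invariant] with m = sqrt delta <= 1/3 keeps al between m and 2. *)
- pose m := Num.sqrt delta.
  have m0 : 0 < m by rewrite sqrtr_gt0.
  have m2 : m ^+ 2 = delta by rewrite sqr_sqrtr// ltW.
  have m5 : m <= 2 / 5 by rewrite -(@ler_sqr R) ?nnegrE//; slra.
  have inv k : (T2 <= k)%N -> m <= al k /\ al k <= 2.
    elim: k => [|k IH].
      rewrite leqn0 => /eqP T20; rewrite T20 in dT2.
      split; last exact: (al_range 0).2.
      by rewrite -(@ler_sqr R) ?nnegrE ?m2 ?alx// ?T20// ltW.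
    rewrite leq_eqVlt => /predU1P[<-|].
      split; last exact: (al_range T2).2.
      by rewrite -(@ler_sqr R) ?nnegrE ?m2 ?alx// ltW.
    by rewrite ltnS => /IH[? ?]; exact: al_invariant.
  move=> k /inv[h1 h2]; rewrite -m2 ler_sqr ?nnegrE; [|slra|slra].
  rewrite h1 /=; have -> : 4 = 2 ^+ 2 :> R by ring.
  by rewrite ler_sqr ?nnegrE; slra.
Qed.

End SignDynamics.

(** * Reduction of polar gradient descent to the sign dynamics *)

Section FrameDynamics.
Variables (R : realType) (d : nat) (w v : 'cV[R]_d).
Hypotheses (ww : w^T *m w = 1%:M) (vv : v^T *m v = 1%:M) (vw : v^T *m w = 0).
Local Notation frame := (frame_mx w v).

Lemma frame_mx_100 : frame 1 0 0 = w *m w^T.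
Proof. by rewrite /frame_mx scale1r !scale0r !addr0. Qed.

Lemma frame_mx_gram (U : 'M[R]_d) a b c : U *m U^T = 1%:M ->
  (frame a b c *m U) *m (frame a b c *m U)^T = frame (a ^+ 2) (b ^+ 2) (c ^+ 2).
Proof.
move=> UU; rewrite trmx_mul tr_frame_mx mulmxA -(mulmxA _ U) UU mulmx1.
by rewrite frame_mxM.
Qed.

(** The gradient is again a frame matrix times U, and s is the trace of D Q. The polar factor keeps
    only signs, so the positive factors 4, 4 L and 4 drop out. *)
Lemma polar_gd_frame_step (U : 'M[R]_d) (L sigma eta a b c : R) :
  U *m U^T = 1%:M -> 0 < L ->
  let s := 1 - a ^+ 2 - L * b ^+ 2 - (d%:R - 2) * c ^+ 2 in
  let W := frame a b c *m U in
  W - eta *: polar (gradW (loss (frame 1 L 1) w sigma) W) =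
  frame (a + eta * Num.sg ((2 * (1 - a ^+ 2) + s) * a))
        (b + eta * Num.sg ((s - 2 * L * b ^+ 2) * b))
        (c + eta * Num.sg ((s - 2 * c ^+ 2) * c)) *m U.
Proof.
move=> UU L0 s W.
rewrite gradW_loss; [|exact: psd_sqrt_frame_ex (ltW L0) _|exact: tr_frame_mx].
rewrite frame_mx_gram// -frame_mx_100 frame_mxN frame_mxD !frame_mxM//.
rewrite mxtrace_frame_mx// !frame_mxZ frame_mxD /W mulmxA frame_mxM// [-4 *:
  _]scalemxAl frame_mxZ.
rewrite polar_frame_mx// [eta *: _]scalemxAl frame_mxZ -mulmxBl frame_mxN frame_mxD.
congr (frame_mx _ _ _ _ _ *m _).
- rewrite -mulrN; congr (_ + _ * _); rewrite -sgrN.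
  set y := (X in Num.sg X); set z := (X in _ = Num.sg X).
  have -> : y = 4 * z by rewrite /y /z /s; ring.
  by rewrite sgrM gtr0_sg ?mul1r.
- rewrite -mulrN; congr (_ + _ * _); rewrite -sgrN.
  set y := (X in Num.sg X); set z := (X in _ = Num.sg X).
  have -> : y = 4 * L * z by rewrite /y /z /s; ring.
  by rewrite sgrM gtr0_sg ?mul1r ?mulr_gt0.
- rewrite -mulrN; congr (_ + _ * _); rewrite -sgrN.
  set y := (X in Num.sg X); set z := (X in _ = Num.sg X).
  have -> : y = 4 * z by rewrite /y /z /s; ring.
  by rewrite sgrM gtr0_sg ?mul1r.
Qed.

Lemma align_frame_mx a b c :
  align (frame a b c) w =
  a / Num.sqrt (a ^+ 2 + b ^+ 2 + (d%:R - 2) * c ^+ 2).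
Proof.
rewrite /align /frob_norm /frob_dot -frame_mx_100 tr_frame_mx !frame_mxM//.
by rewrite !mxtrace_frame_mx// !mulr0 mulr1 !addr0 -!expr2.
Qed.

Fixpoint sign_orbit (L eta theta : R) (k : nat) : R * R * R :=
  if k is k'.+1 then
    let: (a, b, c) := sign_orbit L eta theta k' in
    let s := 1 - a ^+ 2 - L * b ^+ 2 - (d%:R - 2) * c ^+ 2 in
    (a + eta * Num.sg ((2 * (1 - a ^+ 2) + s) * a),
     b + eta * Num.sg ((s - 2 * L * b ^+ 2) * b),
     c + eta * Num.sg ((s - 2 * c ^+ 2) * c))
  else (theta, theta, theta).

Lemma polar_gd_frame (U : 'M[R]_d) (L sigma eta theta : R) k :
  U *m U^T = 1%:M -> 0 < L ->
  let o := sign_orbit L eta theta k in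
  polar_gd (loss (frame 1 L 1) w sigma) eta (theta *: U) k =
  frame o.1.1 o.1.2 o.2 *m U.
Proof.
move=> UU L0; elim: k => [|k IH] /=; first by rewrite frame_mx_scalar mul_scalar_mx.
rewrite IH; case: (sign_orbit _ _ _ _) => -[a b] c /=.
exact: polar_gd_frame_step.
Qed.

End FrameDynamics.

(** * Alignment and parameter estimates *)

(** One has sqrt(a^2 + e) <= a + e/a, and (1 - e/a^2)(a + e/a) = a - e^2/a^3 <= a. *)
Lemma align_lower_bound (R : realType) (a e delta : R) :
  0 < delta -> delta <= a -> 0 <= e ->
  1 - e / delta ^+ 2 <= a / Num.sqrt (a ^+ 2 + e).
Proof.
move=> d0 da e0; have a0 : 0 < a by lra.
have q0 : 0 < Num.sqrt (a ^+ 2 + e) by rewrite sqrtr_gt0 ltr_pwDl ?exprn_gt0.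
have ea0 : 0 <= e / a by rewrite divr_ge0// ltW.
have ub : Num.sqrt (a ^+ 2 + e) <= a + e / a.
  rewrite -(@ler_sqr R) ?nnegrE ?addr_ge0 ?(ltW a0)//.
  rewrite sqr_sqrtr ?addr_ge0 ?sqr_ge0//.
  have -> : (a + e / a) ^+ 2 = a ^+ 2 + 2 * e + (e / a) ^+ 2.
    by field; rewrite gt_eqF.
  by have := sqr_ge0 (e / a); lra.
apply: (@le_trans _ _ (1 - e / a ^+ 2)).
  rewrite lerD2l lerN2 ler_wpM2l// lef_pV2 ?posrE ?exprn_gt0//.
  by rewrite ler_sqr ?nnegrE ?(ltW d0) ?(ltW a0).
rewrite ler_pdivlMr//.
have [h|h] := leP (1 - e / a ^+ 2) 0.
  by apply: (@le_trans _ _ 0); [rewrite mulr_le0_ge0// ltW|exact: ltW].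
apply: (@le_trans _ _ ((1 - e / a ^+ 2) * (a + e / a))).
  by rewrite ler_wpM2l// ltW.
have -> : (1 - e / a ^+ 2) * (a + e / a) = a - (e / a) ^+ 2 / a.
  by field; rewrite gt_eqF.
by rewrite gerBl divr_ge0 ?sqr_ge0// ltW.
Qed.

Lemma cvg_inv_ln_nat (R : realType) (G : R) : G / ln n%:R @[n --> \oo] --> (0 : R).
Proof.
rewrite -[X in _ --> X](mulr0 G); apply: cvgM; first exact: cvg_cst.
apply/gtr0_cvgV0.
  near=> n; rewrite ln_gt0// ltr1n; near: n; exact: nbhs_infty_gt.
apply/cvgryPge => A; near=> n.
have nA : expR A <= n%:R by near: n; exact: nbhs_infty_ger.
by rewrite -ler_expR lnK// posrE (lt_le_trans (expR_gt0 A)).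
Unshelve. all: by end_near. Qed.

(** Both weights 1 + lambda and D - 2 are at most D + lambda, so each product is at most kappa^2. *)
Lemma step_size_bounds (R : realType) (kappa D lambda : R) :
  0 < kappa -> kappa <= 1 / 10 -> 2 <= D -> 0 < lambda ->
  let eta := kappa / Num.sqrt (D + lambda) in
  [/\ 0 < eta, (1 + lambda) * eta ^+ 2 <= 1 / 100,
      (D - 2) * eta ^+ 2 <= 1 / 100
    & exists2 K : nat, 1 <= K%:R * eta & K%:R <= 4 / eta].
Proof.
move=> kp0 kp1 D2 lam0 eta.
have sq0 : 0 < D + lambda by lra.
have eta0 : 0 < eta by rewrite divr_gt0// sqrtr_gt0.
have eta2 : eta ^+ 2 = kappa ^+ 2 / (D + lambda).
  by rewrite /eta expr_div_n sqr_sqrtr// ltW.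
have k2 : kappa ^+ 2 <= 1 / 100.
  have -> : 1 / 100 = (1 / 10) ^+ 2 :> R by field.
  by rewrite ler_sqr ?nnegrE; lra.
have eta_le x : 0 <= x -> x <= D + lambda -> x * eta ^+ 2 <= 1 / 100.
  move=> x0 xd; rewrite eta2 mulrA ler_pdivrMr// mulrC.
  by apply: ler_pM => //; exact: sqr_ge0.
split => //; [apply: eta_le; lra|apply: eta_le; lra|].
have ie0 : 0 <= eta^-1 by rewrite invr_ge0 ltW.
have eta1 : eta <= 1.
  have h : 1 * eta ^+ 2 <= 1 / 100 by apply: eta_le; lra.
  by rewrite -(@ler_sqr R) ?nnegrE ?(ltW eta0)// expr1n; lra.
have ie1 : 1 <= eta^-1 by rewrite invf_ge1.
have /andP[h1 h2] := truncn_itv ie0.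
(* This is at most 1/eta + 1 <= 2/eta, because eta <= 1. *)
exists (Num.trunc eta^-1).+1.
  by rewrite -ler_pdivrMr// div1r ltW.
by rewrite -natr1; lra.
Qed.

(** With [l] the logarithm of the dimension, theta^2 = 1/(l D), and the weight 3 (1 + lambda) + D -
    1 is less than (3 c2 + 3) D <= l D. *)
Lemma init_bound (R : realType) (D l c2 lambda : R) :
  2 <= D -> 0 < c2 -> lambda <= c2 * D -> 3 * c2 + 3 <= l ->
  let theta := Num.sqrt (l^-1 / D) in
  0 < theta /\ theta ^+ 2 * (3 * (1 + lambda) + (D - 2) + 1) < 1.
Proof.
move=> D2 c20 lam hl theta.
have D0 : 0 < D by lra.
have l0 : 0 < l by lra.
have rd0 : 0 < l^-1 / D by rewrite divr_gt0// invr_gt0.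
split; first by rewrite sqrtr_gt0.
rewrite /theta sqr_sqrtr ?(ltW rd0)// -invfM mulrC ltr_pdivrMr ?mulr_gt0// mul1r.
have : (3 * c2 + 3) * D <= l * D by rewrite ler_wpM2r// ltW.
lra.
Qed.

(** Here [b] and [c] are already squared coordinates. From D >= 7 one gets c D <= 3, so c <= 3/l and
    (D - 2) c^2 <= (3/2) c <= 5/l, while b^2 <= b <= 1/(c1 l). *)
Lemma weight_bounds (R : realType) (D l c1 lambda b c : R) :
  7 <= D -> 0 < l -> l < D -> 0 < c1 -> 0 < lambda -> c1 * l <= lambda ->
  0 <= b -> 0 <= c -> (1 + lambda) * b <= 1 / 2 -> (D - 2) * c <= 3 / 2 ->
  [/\ b <= 4 / (1 + lambda), c <= 4 / D
    & b ^+ 2 + (D - 2) * c ^+ 2 <= (c1^-1 + 5) / l].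
Proof.
move=> D7 l0 lD c10 lam0 lam1 b0 c0 hb hc.
have b1 : b <= 1.
  by apply: le_trans (_ : (1 + lambda) * b <= 1); rewrite ?ler_peMl; lra.
have b2 : b <= c1^-1 / l.
  rewrite -invfM -div1r ler_pdivlMr ?mulr_gt0// mulrC.
  apply: le_trans (_ : (1 + lambda) * b <= 1); last by lra.
  by rewrite ler_wpM2r//; lra.
have cD : c * D <= 3.
  have : 0 <= c * (D - 7) by rewrite mulr_ge0//; lra.
  lra.
have c2 : c <= 3 / l.
  by rewrite ler_pdivlMr// (le_trans _ cD)// ler_wpM2l// ltW.
have b4 : b ^+ 2 <= b by rewrite expr2 ler_piMr.
have c4 : (D - 2) * c ^+ 2 <= 3 / 2 * c by rewrite expr2 mulrA ler_wpM2r.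
split.
- by rewrite ler_pdivlMr; lra.
- by rewrite ler_pdivlMr; lra.
- have il0 : 0 < l^-1 by rewrite invr_gt0.
  by rewrite mulrDl; lra.
Qed.

(** * Assembly of the estimates *)

Theorem theorem4p2 (R : realType) :
  forall c1 c2 : R, 0 < c1 -> 0 < c2 ->
  exists kappa0 : R, 0 < kappa0 /\
  forall kappa : R, 0 < kappa -> kappa <= kappa0 ->
  exists delta0 : R, 0 < delta0 /\
  forall delta : R, 0 < delta -> delta <= delta0 ->
  exists (C c : R) (N : nat) (g : nat -> R),
    0 < C /\ 0 < c /\ g @ \oo --> 0 /\
    forall (d : nat) (lambda sigma : R) (wstar v : 'cV[R]_d) (U : 'M[R]_d),
      (N <= d)%N ->
      0 < lambda -> c1 * ln d%:R <= lambda -> lambda <= c2 * d%:R ->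
      wstar^T *m wstar = 1%:M -> v^T *m v = 1%:M -> v^T *m wstar = 0 ->
      U *m U^T = 1%:M ->
      let Q := 1%:M + lambda *: (v *m v^T) in
      let Pperp := 1%:M - wstar *m wstar^T - v *m v^T in
      let L := loss Q wstar sigma in
      let rho0 := (ln d%:R)^-1 in
      let theta := Num.sqrt (rho0 / d%:R) in
      let eta := kappa / Num.sqrt (d%:R + lambda) in
      let Wk := polar_gd L eta (theta *: U) in
      let Mk := fun k => Wk k *m (Wk k)^T in
      exists a b cc : nat -> R,
        (forall k, Mk k = a k *: (wstar *m wstar^T) + b k *: (v *m v^T)
                          + cc k *: Pperp) /\
        exists T1 T2 : nat,
          (* T1 = inf {k >= 0 : b_{k+1} <= b_k} *)
          b T1.+1 <= b T1 /\ (forall k, (k < T1)%N -> b k < b k.+1) /\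
          (* T2 = inf {k >= T1 : a_k >= delta} *)
          (T1 <= T2)%N /\ delta <= a T2 /\
          (forall k, (T1 <= k < T2)%N -> a k < delta) /\
          (* (i) *)
          T2%:R <= C / eta /\
          (* (ii) *)
          (forall k, (T1 <= k <= T2)%N ->
             a k = (Num.sqrt (a 0%N) + k%:R * eta) ^+ 2) /\
          (forall k, (T1 <= k)%N -> `|b k| <= C / (1 + lambda)) /\
          (forall k, (T1 <= k)%N -> `|cc k| <= C / d%:R) /\
          (* for k >= T2 *)
          (forall k, (T2 <= k)%N ->
             c <= a k /\ a k <= C /\ 1 - g d <= align (Mk k) wstar).
Proof.
move=> c1 c2 c10 c20; exists (1 / 10); split; first by lra.
move=> kappa kp0 kp1; exists (1 / 9); split; first by lra.
move=> delta dl0 dl9.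
pose G := (c1^-1 + 5) / delta ^+ 2.
pose A := 3 * c2 + 3.
(* The constant 4 serves T2 <= 4/eta, the bounds on b and c, and a = al^2 <= 2^2. The threshold
   gives d >= 7 and ln d >= 3 c2 + 3. *)
exists 4, delta, (maxn 7 (Num.trunc (expR A)).+1), (fun d => G / ln d%:R).
do 3 (split; first by [|exact: cvg_inv_ln_nat]).
move=> d lambda sigma wstar v U; rewrite geq_max => /andP[d7 dA] lam0 lam1 lam2.
move=> ww vv vw UU Q Pperp L rho0 theta eta Wk Mk.
have d7R : 7 <= d%:R :> R by rewrite (ler_nat R 7 d).
have d2R : 2 <= d%:R :> R by rewrite (ler_nat R 2 d) (leq_trans _ d7).
have d0R : 0 < d%:R :> R by rewrite ltr0n (leq_trans _ d7).
have n5 : 5 <= d%:R - 2 :> R by rewrite lerBrDr -natrD.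
have lnA : A <= ln d%:R.
  have /andP[_ h] := truncn_itv (expR_ge0 A).
  by rewrite -ler_expR lnK ?posrE// (le_trans (ltW h))// ler_nat.
have ln0 : 0 < ln (d%:R : R) by rewrite ln_gt0// ltr1n (leq_trans _ d7).
have lnd : ln (d%:R : R) < d%:R by exact: ln_sublinear.
pose L1 : R := 1 + lambda.
have L11 : 1 <= L1 by rewrite lerDl ltW.
have QE : Q = frame_mx wstar v 1 L1 1.
  have -> : frame_mx wstar v 1 L1 1 =
      frame_mx wstar v 1 1 1 + frame_mx wstar v 0 lambda 0.
    by rewrite frame_mxD !addr0.
  by rewrite frame_mx_scalar /frame_mx !scale0r add0r addr0.
have [eta0 Leta neta [K K1 K2]] := step_size_bounds kp0 kp1 d2R lam0.
have [theta0 theta_small] := init_bound d2R c20 lam2 lnA.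
rewrite -/eta -/L1 in eta0 Leta neta K1 K2; rewrite -/L1 in theta_small.
pose o k := sign_orbit d L1 eta theta k.
pose al k := (o k).1.1; pose be k := (o k).1.2; pose ga k := (o k).2.
have MkE k : Mk k = frame_mx wstar v (al k ^+ 2) (be k ^+ 2) (ga k ^+ 2).
  rewrite /Mk (_ : Wk k = frame_mx wstar v (al k) (be k) (ga k) *m U).
    by rewrite frame_mx_gram.
  by rewrite /Wk /L QE polar_gd_frame// (lt_le_trans ltr01).
have oS k : o k.+1 = let: (a, b, c) := (al k, be k, ga k) in
    let s := 1 - a ^+ 2 - L1 * b ^+ 2 - (d%:R - 2) * c ^+ 2 in
    (a + eta * Num.sg ((2 * (1 - a ^+ 2) + s) * a),
     b + eta * Num.sg ((s - 2 * L1 * b ^+ 2) * b),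
     c + eta * Num.sg ((s - 2 * c ^+ 2) * c)).
  by rewrite /al /be /ga {1}/o /= -/(o k); case: (o k) => -[].
have alS k : al k.+1 = _ := congr1 (fun t => t.1.1) (oS k).
have beS k : be k.+1 = _ := congr1 (fun t => t.1.2) (oS k).
have gaS k : ga k.+1 = _ := congr1 (fun t => t.2) (oS k).
have al0 : al 0%N = theta by [].
have be0 : be 0%N = theta by [].
have ga0 : ga 0%N = theta by [].
have bB := be_sqr_bound n5 L11 eta0 theta0 Leta neta theta_small be0 beS.
have gB := ga_sqr_bound n5 L11 eta0 theta0 Leta neta theta_small ga0 gaS.
have [T1 [T2 [h1 [h2 [h3 [h4 [h5 [h6 [h7 h8]]]]]]]]] :=
  sign_dynamics n5 L11 eta0 theta0 Leta neta theta_small al0 be0 ga0 alS beS gaS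
    dl0 dl9 K1.
have wB k := weight_bounds d7R ln0 lnd c10 lam0 lam1 (sqr_ge0 _) (sqr_ge0 _)
  (bB k) (gB k).
exists (fun k => al k ^+ 2), (fun k => be k ^+ 2), (fun k => ga k ^+ 2).
split; first by move=> k; rewrite MkE.
exists T1, T2; do 5 (split; first by []).
split; first by apply: le_trans K2; rewrite ler_nat.
split.
  move=> k /andP[_ kT]; rewrite h7//; congr ((_ + _) ^+ 2).
  by rewrite al0 sqrtr_sqr ger0_norm// ltW.
split; first by move=> k _; rewrite ger0_norm ?sqr_ge0//; case: (wB k).
split; first by move=> k _; rewrite ger0_norm ?sqr_ge0//; case: (wB k).
move=> k kT; have /andP[da a4] := h8 k kT; split=> //; split=> //.
rewrite MkE align_frame_mx// -addrA.
(* The off-target energy e is at most (c1^-1 + 5)/ln d, so the alignment deficit e/delta^2 is at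
   most G/ln d. *)
set e := (X in _ <= _ / Num.sqrt (_ + X)).
have e0 : 0 <= e.
  by rewrite addr_ge0 ?sqr_ge0// mulr_ge0 ?sqr_ge0// (le_trans _ n5).
apply: (le_trans _ (align_lower_bound dl0 da e0)).
rewrite lerD2l lerN2 /G mulrAC ler_wpM2r ?invr_ge0 ?sqr_ge0//.
by case: (wB k).
Qed.
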